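(* Let $m^0\in\mathcal{P}_N$ and let $t\in[0,T]\mapsto(u(t,1),\dots,u(t,N),m(t,1),\dots,m(t,N))$ be a $C^1$ solution of the $\mathcal{G}$-MFG equations with $(m(0,1),\dots,m(0,N))=m^0$. Then $t\mapsto m(t)=(m(t,1),\dots,m(t,N))$ is a Nash-MFG equilibrium, and the relations $$\lambda_t(i,j)=\frac{\partial H(i,\cdot)}{\partial p_j}\big((u(t,k)-u(t,i))_{k\in\mathcal{V}(i)}\big),\qquad i\in\mathcal{N},\ j\in\mathcal{V}(i),$$ define an optimal control.
   Context: Setting. $\mathcal{G}$ is a directed graph with nodes $\mathcal{N}=\{1,\dots,N\}$; $\mathcal{V}(i)\subset\mathcal{N}\setminus\{i\}$ is the set of $j$ with a directed edge from $i$ to $j$, $d_i=|\mathcal{V}(i)|$, and $\mathcal{V}^{-1}(i)\subset\mathcal{N}\setminus\{i\}$ is the set of $j$ with a directed edge from $j$ to $i$. Vectors of $\mathbb{R}^{d_i}$ are indexed by $\mathcal{V}(i)$. $T>0$ is fixed. For each $i$, $L(i,\cdot):\mathbb{R}_+^{d_i}\to\mathbb{R}$ is continuous with $\lim_{|\lambda|\to+\infty}L(i,\lambda)/|\lambda|=+\infty$. The Hamiltonian is $H(i,p)=\sup_{\lambda\in\mathbb{R}_+^{d_i}}\big(\lambda\cdot p-L(i,\lambda)\big)$ for $p\in\mathbb{R}^{d_i}$; it is assumed that each $H(i,\cdot)$ is $C^1$ with $\nabla H(i,p)=\mathrm{argmax}_{\lambda\in\mathbb{R}_+^{d_i}}\big(\lambda\cdot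 p-L(i,\lambda)\big)$. $\frac{\partial H(i,\cdot)}{\partial p_j}$, $j\in\mathcal{V}(i)$, is the partial derivative in the coordinate indexed by $j$. $\mathcal{P}_N=\{x\in[0,1]^N:\sum_i x_i=1\}$; $\Omega\subset\mathbb{R}^N$ is a domain (open connected set) containing $\mathcal{P}_N$; $f,g:\mathcal{N}\times\Omega\to\mathbb{R}$ with $f(i,\cdot),g(i,\cdot)$ continuous on $\Omega$ for each $i$. For a curve $m$ write $m(t)=(m(t,1),\dots,m(t,N))$. Admissible controls: $\mathcal{A}$ is the set of deterministic families $(\lambda_t(i,j))_{t\in[0,T],\,i\in\mathcal{N},\,j\in\mathcal{V}(i)}$ with values in $\mathbb{R}_+$ such that $t\mapsto\lambda_t(i,j)\in L^\infty(0,T)$ for all $i$ and $j\in\mathcal{V}(i)$. For $m:[0,T]\to\mathcal{P}_N$, $\lambda\in\mathcal{A}$, $$J_m(t,i,\lambda)=\mathbb{E}\Big[\int_t^T\big(-L(X_s,\lambda_s(X_s,\cdot))+f(X_s,m(s))\big)ds+g(X_T,m(T))\Big],$$ where $(X_s)_{s\in[t,T]}$ is a continuous-time Markov chain on $\mathcal{N}$ starting from $i$ at time $t$ with instantaneous transition rates $\lambda_s(i,j)$. A differentiable function $m:[0,T]\to\mathcal{P}_N$ is a Nash-MFG equilibrium if there is $\lambda\in\mathcal{A}$ (then called an optimal control) such that $J_m(0,i,\lambda)\ge J_m(0,i,\tilde\lambda)$ for all $\tilde\lambda\in\mathcal{A}$, $i\in\mathcal{N}$, and $\frac{d}{dt}m(t,i)=\sum_{j\in\mathcal{V}^{-1}(i)}\lambda_t(j,i)m(t,j)-\sum_{j\in\mathcal{V}(i)}\lambda_t(i,j)m(t,i)$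 for all $i\in\mathcal{N}$. $\mathcal{G}$-MFG equations (unknown $(u,m):[0,T]\to\mathbb{R}^N\times\Omega$, with $m^0\in\mathcal{P}_N$ given): for all $i\in\mathcal{N}$, $$\frac{d}{dt}u(t,i)+H\big(i,(u(t,j)-u(t,i))_{j\in\mathcal{V}(i)}\big)+f(i,m(t))=0,\qquad u(T,i)=g(i,m(T)),$$ $$\frac{d}{dt}m(t,i)=\sum_{j\in\mathcal{V}^{-1}(i)}\frac{\partial H(j,\cdot)}{\partial p_i}\big((u(t,k)-u(t,j))_{k\in\mathcal{V}(j)}\big)m(t,j)-\sum_{j\in\mathcal{V}(i)}\frac{\partial H(i,\cdot)}{\partial p_j}\big((u(t,k)-u(t,i))_{k\in\mathcal{V}(i)}\big)m(t,i),$$ with $m(0)=m^0$. *)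

(* Defs.v *)
From HB Require Import structures.
From mathcomp Require Import all_boot all_order all_algebra.
From mathcomp Require Import all_classical all_reals all_analysis.
Set Implicit Arguments.
Unset Strict Implicit.
Unset Printing Implicit Defensive.
Import Order.TTheory GRing.Theory Num.Theory.
Import numFieldNormedType.Exports.
Local Open Scope classical_set_scope.
Local Open Scope ring_scope.

(* A directed graph on 'I_N is given by its out-neighbourhoods
   V : 'I_N -> {set 'I_N} (with i \notin V i), so that V^{-1}(i) is
   [set j | i \in V j].  A vector indexed by V i is a row vector of length
   #|V i| whose k-th entry is the coordinate attached to the node
   [enum_val k], the k-th element of V i. *)
Definition vec (R : realType) (N : nat) (V : 'I_N -> {set 'I_N}) (i : 'I_N)
    (x : 'I_N -> R) : 'rV[R]_#|V i| :=
  \row_(k < #|V i|) x (enum_val k).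

Definition orthant (R : realType) (n : nat) : set 'rV[R]_n :=
  [set l | forall k, 0 <= l 0 k].

Definition dot (R : realType) (n : nat) (x y : 'rV[R]_n) : R :=
  \sum_k x 0 k * y 0 k.

(* The partial derivative in the coordinate attached to j: for j \in V i the
   direction is the corresponding canonical basis vector. *)
Definition partial (R : realType) (N : nat) (V : 'I_N -> {set 'I_N}) (i : 'I_N)
    (F : 'rV[R]_#|V i| -> R) (j : 'I_N) (p : 'rV[R]_#|V i|) : R :=
  'D_(vec V i (fun k => (k == j)%:R)) F p.

Definition grad (R : realType) (N : nat) (V : 'I_N -> {set 'I_N}) (i : 'I_N)
    (F : 'rV[R]_#|V i| -> R) (p : 'rV[R]_#|V i|) : 'rV[R]_#|V i| :=
  vec V i (fun j => partial F j p).

Definition C1_fun (R : realType) (N : nat) (V : 'I_N -> {set 'I_N}) (i : 'I_N)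
    (F : 'rV[R]_#|V i| -> R) : Prop :=
  (forall p, differentiable F p) /\
  (forall j, j \in V i -> continuous (partial F j)).

Definition superlinear (R : realType) (n : nat) (L : 'rV[R]_n -> R) : Prop :=
  forall A : R, exists B : R, forall l : 'rV[R]_n,
    orthant l -> B <= `|l| -> 0 < `|l| -> A <= L l / `|l|.

Definition hamiltonian (R : realType) (n : nat) (L : 'rV[R]_n -> R)
    (p : 'rV[R]_n) : R :=
  sup [set dot l p - L l | l in @orthant R n].

Definition argmax (R : realType) (n : nat) (L : 'rV[R]_n -> R)
    (p : 'rV[R]_n) : set 'rV[R]_n :=
  [set l | orthant l /\
           forall l', orthant l' -> dot l' p - L l' <= dot l p - L l].

Definition simplex (R : realType) (N : nat) : set 'rV[R]_N :=
  [set x | (forall i, 0 <= x 0 i <= 1) /\ \sum_i x 0 i = 1].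

(* Derivatives relative to [0, T]: one-sided at the endpoints. *)
Definition dquot (R : realType) (h : R -> R) (t s : R) : R :=
  (s - t)^-1 * (h s - h t).

Definition derivable_on (R : realType) (T : R) (h : R -> R) : Prop :=
  forall t, t \in `[0, T] -> cvg (dquot h t s @[s --> within `[0, T] t^']).

Definition derive_on (R : realType) (T : R) (h : R -> R) (t : R) : R :=
  lim (dquot h t s @[s --> within `[0, T] t^']).

Definition C1_on (R : realType) (T : R) (h : R -> R) : Prop :=
  derivable_on T h /\ {within `[0, T], continuous (derive_on T h)}.

(* A control is lam : R -> 'I_N -> 'I_N -> R, where lam t i j stands for
   lambda_t(i, j); only t in [0, T] and j \in V i are relevant. *)
Definition essentially_bounded (R : realType) (T : R) (h : R -> R) : Prop :=
  exists M : R, {ae lebesgue_measure, forall t, t \in `[0, T] -> `|h t| <= M}.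

Definition admissible (R : realType) (N : nat) (V : 'I_N -> {set 'I_N}) (T : R)
    (lam : R -> 'I_N -> 'I_N -> R) : Prop :=
  forall i j, j \in V i ->
    [/\ forall t, t \in `[0, T] -> 0 <= lam t i j,
        measurable_fun `[0, T] (fun t => lam t i j)
      & essentially_bounded T (fun t => lam t i j)].

Definition rate_matrix (R : realType) (N : nat) (V : 'I_N -> {set 'I_N})
    (lam : 'I_N -> 'I_N -> R) : 'M[R]_N :=
  \matrix_(j, k) (if j == k then - \sum_(l in V j) lam j l
                  else if k \in V j then lam j k else 0).

(* p s r j k is the probability of being in k at time r from j at time s.
   Since the rates are only measurable and essentially bounded in time,
   they are prescribed through Kolmogorov's forward equation
   (d/dr) p s r = p s r *m Q r, p s s = 1, in integrated form. *)
Definition transition_function (R : realType) (N : nat)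
    (V : 'I_N -> {set 'I_N}) (t T : R) (lam : R -> 'I_N -> 'I_N -> R)
    (p : R -> R -> 'M[R]_N) : Prop :=
  forall s, s \in `[t, T] -> forall j,
    [/\ forall r, r \in `[s, T] ->
          (forall k, 0 <= p s r j k) /\ \sum_k p s r j k = 1,
        forall k, measurable_fun `[s, T] (fun r => p s r j k)
      & forall r, r \in `[s, T] -> forall k,
          p s r j k = (j == k)%:R +
            \int[lebesgue_measure]_(v in `[s, r])
               (p s v *m rate_matrix V (lam v)) j k].

(* X is a Markov jump process on [t, T] started from i, with right-continuous
   paths having left limits.  The Markov property is stated on finite
   histories h = [:: (s_1, k_1); ...; (s_n, k_n)] with all s_l in [t, s]. *)
Definition markov_chain (R : realType) (N : nat) (V : 'I_N -> {set 'I_N})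
    (t T : R) (i : 'I_N) (lam : R -> 'I_N -> 'I_N -> R)
    (d : measure_display) (Om : measurableType d) (P : probability Om R)
    (X : R -> Om -> 'I_N) : Prop :=
  [/\ forall s, s \in `[t, T] -> forall k, measurable [set w | X s w = k],
      forall w,
        (forall s, s \in `[t, T[ -> \forall r \near s^'+, X r w = X s w) /\
        (forall s, s \in `]t, T] ->
           exists k, \forall r \near s^'-, X r w = k),
      P [set w | X t w = i] = 1%E
    & exists p : R -> R -> 'M[R]_N,
        transition_function V t T lam p /\
        forall (s r : R) (h : seq (R * 'I_N)) (j k : 'I_N),
          t <= s -> s <= r -> r <= T ->
          (forall c, c \in h -> t <= c.1 <= s) ->
          P [set w | [/\ forall c, c \in h -> X c.1 w = c.2,
                         X s w = j & X r w = k]] =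
          (P [set w | (forall c, c \in h -> X c.1 w = c.2) /\ X s w = j]
           * (p s r j k)%:E)%E].

Definition expected_payoff (R : realType) (N : nat) (V : 'I_N -> {set 'I_N})
    (T : R) (L : forall i, 'rV[R]_#|V i| -> R) (f g : 'I_N -> 'rV[R]_N -> R)
    (m : R -> 'rV[R]_N) (t : R) (lam : R -> 'I_N -> 'I_N -> R)
    (d : measure_display) (Om : measurableType d) (P : probability Om R)
    (X : R -> Om -> 'I_N) : \bar R :=
  expectation P (fun w =>
    \int[lebesgue_measure]_(s in `[t, T])
       (- L (X s w) (vec V (X s w) (lam s (X s w))) + f (X s w) (m s))
    + g (X T w) (m T)).

(* J m t i lam v: v is the value of J_m(t, i, lambda), computed on some
   probability space carrying a Markov chain with rates lam started from i
   at time t. *)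
Definition J (R : realType) (N : nat) (V : 'I_N -> {set 'I_N})
    (T : R) (L : forall i, 'rV[R]_#|V i| -> R) (f g : 'I_N -> 'rV[R]_N -> R)
    (m : R -> 'rV[R]_N) (t : R) (i : 'I_N) (lam : R -> 'I_N -> 'I_N -> R)
    (v : \bar R) : Prop :=
  exists (d : measure_display) (Om : measurableType d) (P : probability Om R)
         (X : R -> Om -> 'I_N),
    markov_chain V t T i lam P X /\
    v = expected_payoff T L f g m t lam P X.

Definition optimal_control (R : realType) (N : nat) (V : 'I_N -> {set 'I_N})
    (T : R) (L : forall i, 'rV[R]_#|V i| -> R) (f g : 'I_N -> 'rV[R]_N -> R)
    (m : R -> 'rV[R]_N) (lam : R -> 'I_N -> 'I_N -> R) : Prop :=
  [/\ admissible V T lam,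
      forall lam', admissible V T lam' -> forall i v v',
        J T L f g m 0 i lam v -> J T L f g m 0 i lam' v' -> (v' <= v)%E
    & forall i t, t \in `[0, T] ->
        derive_on T (fun s => m s 0 i) t =
          \sum_(j | i \in V j) lam t j i * m t 0 j
          - \sum_(j in V i) lam t i j * m t 0 i].

Definition nash_mfg_equilibrium (R : realType) (N : nat)
    (V : 'I_N -> {set 'I_N}) (T : R) (L : forall i, 'rV[R]_#|V i| -> R)
    (f g : 'I_N -> 'rV[R]_N -> R) (m : R -> 'rV[R]_N) : Prop :=
  [/\ forall t, t \in `[0, T] -> simplex (m t),
      forall i, derivable_on T (fun s => m s 0 i)
    & exists lam, optimal_control T L f g m lam].

Definition diffs (R : realType) (N : nat) (V : 'I_N -> {set 'I_N}) (i : 'I_N)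
    (x : 'rV[R]_N) : 'rV[R]_#|V i| :=
  vec V i (fun j => x 0 j - x 0 i).

Definition mfg_equations (R : realType) (N : nat) (V : 'I_N -> {set 'I_N})
    (T : R) (H : forall i, 'rV[R]_#|V i| -> R) (f g : 'I_N -> 'rV[R]_N -> R)
    (m0 : 'rV[R]_N) (u m : R -> 'rV[R]_N) : Prop :=
  [/\ forall i t, t \in `[0, T] ->
        derive_on T (fun s => u s 0 i) t
          + H i (diffs V i (u t)) + f i (m t) = 0,
      forall i, u T 0 i = g i (m T),
      forall i t, t \in `[0, T] ->
        derive_on T (fun s => m s 0 i) t =
          \sum_(j | i \in V j) partial (H j) i (diffs V j (u t)) * m t 0 j
          - \sum_(j in V i) partial (H i) j (diffs V i (u t)) * m t 0 i
    & m 0 = m0].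

(* Main.v *)
Require Import Defs.
From HB Require Import structures.
From mathcomp Require Import all_boot all_order all_algebra.
From mathcomp Require Import all_classical all_reals all_analysis.
From mathcomp Require Import measurable_realfun ring lra.
Set Implicit Arguments.
Unset Strict Implicit.
Unset Printing Implicit Defensive.
Import Order.TTheory GRing.Theory Num.Theory.
Import numFieldNormedType.Exports.
Local Open Scope classical_set_scope.
Local Open Scope ring_scope.

(* Along the Markov chain of a control [lam] started from [i], with law [q s],
   the product rule applied to the sum of the [q s j * u s j], together with
   the forward equation for [q] and the backward equation for [u], gives
     payoff = u 0 i + int_0^T sum_j q s j * gap s j,
   where [gap s j = lam . p - L j lam - H j p] with [p = (u s k - u s j)_k].
   The gap is nonpositive because [H] is a supremum, and it vanishes for
   [lam = grad H p], the maximizer; hence this control is optimal.  The curve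
   [m] stays in the simplex because it solves the linear forward equation of a
   rate matrix. *)

(** * Derivatives relative to a segment *)

(** Controls are merely measurable and essentially bounded in time, so the law [q] need not be
    differentiable at every time and the product rule has to be run in integrated form. The payoff
    is an expectation along paths, whereas the argument concerns the law: right continuity makes the
    events [X s = k] jointly measurable in time and sample, and Fubini then turns the path integral
    into an integral against [q]. Since [J] allows any probability space carrying a suitable chain,
    the payoff identity is proved for each of them; the comparison then rests on [q >= 0] alone, and
    for the maximizing control the integral vanishes whatever [q] is. For the simplex, zero row sums
    of the rate matrix preserve mass and nonnegative off-diagonal rates preserve sign. The sign is
    the delicate half: the equation gives only non-strict inequalities at a minimum, and an
    exponential weight supplies the missing strictness. *)

Lemma derive_on_near (R : realType) (T : R) (h : R -> R) (t e : R) :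
  derivable_on T h -> t \in `[0, T] -> 0 < e ->
  \forall s \near t, s \in `[0, T] -> s != t ->
    `|derive_on T h t - dquot h t s| < e.
Proof.
move=> dh tT e0; have /cvgrPdist_lt/(_ e e0) := dh t tT.
move=> H; have {}H : nbhs t (fun s => s != t -> `[0, T]%classic s ->
  `|derive_on T h t - dquot h t s| < e) by exact: H.
by apply: filterS H => s H sT st; apply: H.
Qed.

Lemma is_derive_on (R : realType) (T : R) (h : R -> R) (t : R) :
  derivable_on T h -> t \in `]0, T[ -> is_derive t 1 h (derive_on T h t).
Proof.
move=> dh tT; have tT' : t \in `[0, T] by apply: subset_itv_oo_cc.
apply/is_derive1_caratheodory.
(* This is the slope function of Carathéodory's criterion, completed at [t] by the limit. As [t] is
   interior, all nearby points lie in [[0, T]], so the relative limit is a full one. *)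
exists (fun z => if z == t then derive_on T h t else dquot h t z).
split; last by rewrite eqxx.
  move=> z; case: eqVneq => [->|zt]; first by rewrite !subrr mulr0.
  by rewrite /dquot mulrAC mulVf ?mul1r// subr_eq0.
apply/cvgrPdist_lt => e e0; rewrite eqxx.
near=> s; case: eqVneq => [_|st]; first by rewrite subrr normr0.
move: st; near: s.
have := derive_on_near dh tT' e0; have := near_in_itvoo tT.
apply: filterS2 => s sT H; apply: H; exact: subset_itv_oo_cc.
Unshelve. all: by end_near.
Qed.

Lemma derivable_on_continuous (R : realType) (T : R) (h : R -> R) :
  derivable_on T h -> {within `[0, T], continuous h}.
Proof.
move=> dh; apply/subspace_continuousP => t /= tT.
apply/cvgrPdist_lt => e e0.
have := derive_on_near dh tT ltr01.
(* Near [t] the difference quotient is within 1 of the derivative; this bounds it by the constant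
   [c0] speaks of and fixes the radius of the ball. *)
have c0 : 0 < 1 + `|derive_on T h t| by rewrite ltr_pwDl.
have : \forall s \near t, `|t - s| < e / (1 + `|derive_on T h t|).
  by apply/nbhs_ballP; exists (e / (1 + `|derive_on T h t|)) => //=;
    rewrite divr_gt0.
apply: filterS2 => s st H sT; have [->|ts] := eqVneq s t.
  by rewrite subrr normr0.
have {}H := H sT ts; move: st; rewrite ltr_pdivlMr// => st.
have -> : h t - h s = dquot h t s * (t - s).
  by rewrite /dquot -(opprB s t) mulrN mulrAC mulVf ?mul1r ?subr_eq0// opprB.
rewrite normrM mulrC; apply: le_lt_trans st.
apply: ler_wpM2l => //; rewrite -(subrK (derive_on T h t) (dquot h t s)).
by rewrite (le_trans (ler_normD _ _))// lerD2r distrC ltW.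
Qed.

(** Points strictly between [s] and [r] are interior to [[0, T]], so the relative derivative is an
    ordinary one there; at [s] and [r] themselves only continuity of [h] is asked for. The
    degenerate case [s = r] is treated apart. *)
Lemma C1_on_FTC (R : realType) (T : R) (h : R -> R) (s r : R) :
  C1_on T h -> 0 <= s -> s <= r -> r <= T ->
  \int[lebesgue_measure]_(v in `[s, r]) derive_on T h v = h r - h s.
Proof.
move=> [dh ch] s0; rewrite le_eqVlt => /predU1P[<- _|sr rT].
  by rewrite set_itv1 Rintegral_set1 subrr.
have sub : `[s, r] `<=` `[0, T].
  by apply: subset_itv; rewrite bnd_simp.
rewrite /Rintegral (@continuous_FTC2 _ _ h)//.
- exact: continuous_subspaceW ch.
- have /(continuous_within_itvP _ sr)[_ hs hr] :=
    continuous_subspaceW sub (derivable_on_continuous dh).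
  split => // x xsr; apply: (@ex_derive _ _ _ _ _ _ _ (is_derive_on dh _)).
  by apply: subset_itv xsr; rewrite bnd_simp.
- move=> x xsr; rewrite derive1E.
  apply: (@derive_val _ _ _ _ _ _ _ (is_derive_on dh _)).
  by apply: subset_itv xsr; rewrite bnd_simp.
Qed.

Lemma row_cvg (R : realType) (S : Type) (F : set_system S) {FF : Filter F}
    (n : nat) (h : S -> 'rV[R]_n) (l : 'rV[R]_n) :
  (forall k, h x 0 k @[x --> F] --> l 0 k) -> h x @[x --> F] --> l.
Proof.
move=> hl; apply/cvg_mx_entourageP => A eA.
have : \forall x \near F, forall k, (l 0 k, h x 0 k) \in A.
  apply: (@filter_forall _ _ (fun k x => (l 0 k, h x 0 k) \in A)) => k.
  have /cvg_entourageP/(_ A eA) := hl k.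
  move=> H; have {}H : F (fun x => A (l 0 k, h x 0 k)) by exact: H.
  by apply: filterS H => x; rewrite inE.
move=> H; have {}H : F (fun x => forall k, (l 0 k, h x 0 k) \in A) by exact: H.
apply: (@filterS _ F FF _ _ _ H) => x /= Hx i k.
by rewrite (ord1 i); apply: Hx.
Qed.

(** Cut [[0, T]] into [n.+1] equal pieces: each contributes at most [K * (T / n.+1) ^ 2], so the
    total is [K * T ^ 2 / n.+1], which is arbitrarily small. The sign of [K] is free, whence [|K|]
    in the choice of [n]. *)
Lemma quadratic_increments_constant (R : realType) (T K : R) (F : R -> R) :
  0 <= T ->
  (forall s r, 0 <= s -> s <= r -> r <= T -> `|F r - F s| <= K * (r - s) ^+ 2) ->
  F T = F 0.
Proof.
move=> T0 HF.
have step (n k : nat) : (k <= n.+1)%N ->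
    `|F (T * k%:R / n.+1%:R) - F 0| <= k%:R * (K * (T / n.+1%:R) ^+ 2).
  elim: k => [|k IH] kn; first by rewrite mulr0 !mul0r subrr normr0.
  have n0 : (0 : R) < n.+1%:R by rewrite ltr0n.
  have -> : F (T * k.+1%:R / n.+1%:R) - F 0 =
    (F (T * k.+1%:R / n.+1%:R) - F (T * k%:R / n.+1%:R)) +
    (F (T * k%:R / n.+1%:R) - F 0) by rewrite addrA subrK.
  apply: (le_trans (ler_normD _ _)).
  rewrite -natr1 [leRHS]mulrDl mul1r addrC; apply: lerD.
    exact/IH/ltnW.
  have -> : T / n.+1%:R =
      T * (k%:R + 1) / n.+1%:R - T * k%:R / n.+1%:R.
    by rewrite -mulrBl -mulrBr addrC addKr mulr1.
  apply: HF.
  - by rewrite divr_ge0// mulr_ge0.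
  - by rewrite ler_pM2r ?invr_gt0// ler_wpM2l// lerDl.
  - rewrite ler_pdivrMr// ler_wpM2l// natr1 ler_nat//.
apply/eqP; rewrite -subr_eq0 -normr_le0; apply/ler_addgt0Pl => e e0.
rewrite addr0.
have [n hn] : exists n : nat, `|K| * T ^+ 2 / e < n.+1%:R.
  exists (Num.truncn (`|K| * T ^+ 2 / e)).
  by apply: truncnS_gt.
have n0 : (0 : R) < n.+1%:R by rewrite ltr0n.
have := step n n.+1 (leqnn _); rewrite -mulrA divff ?mulr1 ?lt0r_neq0//.
move=> /le_trans; apply.
move: hn; rewrite ltr_pdivrMr// => /ltW hn.
have -> : n.+1%:R * (K * (T / n.+1%:R) ^+ 2) = K * T ^+ 2 / n.+1%:R.
  by field; rewrite lt0r_neq0.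
rewrite ler_pdivrMr// mulrC [leRHS]mulrC; apply: le_trans hn.
by rewrite mulrC ler_wpM2r ?sqr_ge0// ler_norm.
Qed.

(** * Essentially bounded functions of time *)

(** This is the regularity of an admissible rate. It is stable under sums and products, contains the
    functions continuous on [[0, T]], and implies integrability on subsegments. *)
Definition bounded_measurable (R : realType) (T : R) (h : R -> R) : Prop :=
  measurable_fun `[0, T] h /\ essentially_bounded T h.

#[local] Instance lebesgue_ae_filter (R : realType) :
  Filter (nbhs (almost_everywhere (@lebesgue_measure R))).
Proof. exact: (@ae_filter_ringOfSetsType _ _ _ (@lebesgue_measure R)). Qed.

Lemma essentially_bounded_pos (R : realType) (T : R) (h : R -> R) :
  essentially_bounded T h ->
  exists2 M, 0 <= M &
    {ae lebesgue_measure, forall t, t \in `[0, T] -> `|h t| <= M}.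
Proof.
move=> [M hM]; exists `|M| => //; apply: filterS hM => t H tT.
exact: le_trans (H tT) (ler_norm _).
Qed.

Section bounded_measurable_theory.
Context (R : realType) (T : R).
Implicit Types h g : R -> R.
Local Notation mu := (@lebesgue_measure R).

Lemma continuous_within_bounded h : {within `[0, T], continuous h} ->
  exists2 M, 0 <= M & forall t, t \in `[0, T] -> `|h t| <= M.
Proof.
move=> ch; have := continuous_compact ch (@segment_compact _ _ _).
move/compact_bounded => [M [_ /(_ (`|M| + 1))]].
rewrite (le_lt_trans (ler_norm _)) ?ltrDl// => /(_ isT) HM.
by exists (`|M| + 1); [rewrite addr_ge0|move=> t tT; apply: HM; exists t].
Qed.

Lemma bounded_measurable_continuous h :
  {within `[0, T], continuous h} -> bounded_measurable T h.
Proof.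
move=> ch; split; first exact: subspace_continuous_measurable_fun.
by have [M M0 hM] := continuous_within_bounded ch; exists M; apply: aeW.
Qed.

Lemma bounded_measurable_cst (c : R) : bounded_measurable T (fun=> c).
Proof. by split=> //; exists `|c|; apply: aeW. Qed.

Lemma bounded_measurableD h g : bounded_measurable T h ->
  bounded_measurable T g -> bounded_measurable T (fun t => h t + g t).
Proof.
move=> [mh [M hM]] [mg [M' gM]]; split; first exact: measurable_funD.
exists (M + M'); apply: filterS2 hM gM => t H G tT.
by rewrite (le_trans (ler_normD _ _))// lerD ?H ?G.
Qed.

Lemma bounded_measurableM h g : bounded_measurable T h ->
  bounded_measurable T g -> bounded_measurable T (fun t => h t * g t).
Proof.
move=> [mh bh] [mg bg]; split; first exact: measurable_funM.
have [M M0 hM] := essentially_bounded_pos bh.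
have [M' M'0 gM] := essentially_bounded_pos bg.
exists (M * M'); apply: filterS2 hM gM => t H G tT.
by rewrite normrM ler_pM ?H ?G.
Qed.

Lemma bounded_measurableN h : bounded_measurable T h ->
  bounded_measurable T (fun t => - h t).
Proof.
move=> [mh [M hM]]; split; first exact: measurableT_comp.
by exists M; apply: filterS hM => t H tT; rewrite normrN H.
Qed.

Lemma bounded_measurable_sum (I : finType) (P : pred I) (h : I -> R -> R) :
  (forall i, P i -> bounded_measurable T (h i)) ->
  bounded_measurable T (fun t => \sum_(i | P i) h i t).
Proof.
move=> Hh.
have -> : (fun t => \sum_(i | P i) h i t) = \sum_(i | P i) h i.
  by apply/funext => t; rewrite fct_sumE.
apply: (big_ind (bounded_measurable T)) => //.
- exact: bounded_measurable_cst.
- by move=> x y; exact: bounded_measurableD.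
Qed.

Lemma bounded_measurable_integrable h s r : bounded_measurable T h ->
  0 <= s -> r <= T -> mu.-integrable `[s, r] (EFin \o h).
Proof.
move=> [mh bh] s0 rT.
have sub : `[s, r] `<=` `[0, T] by apply: subset_itv; rewrite bnd_simp.
apply: (@integrableS _ _ R mu _ _ _ _ _ sub) => //.
have [M M0 hM] := essentially_bounded_pos bh.
apply/integrableP; split; first exact/measurable_EFinP.
apply: (@le_lt_trans _ _ (\int[mu]_(x in `[0%R, T]) (M%:E))%E).
  apply: ae_ge0_le_integral => //.
  by apply: measurableT_comp => //; exact/measurable_EFinP.
rewrite integral_cst//= lebesgue_measure_itv/=; case: ifPn => _.
  by rewrite -EFinB -EFinM ltry.
by rewrite mule0 ltry.
Qed.

Lemma le_norm_Rintegral_ae h s r (M : R) : bounded_measurable T h ->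
  0 <= s -> s <= r -> r <= T -> 0 <= M ->
  {ae mu, forall t, t \in `[s, r] -> `|h t| <= M} ->
  `|\int[mu]_(v in `[s, r]) h v| <= M * (r - s).
Proof.
move=> bh s0 sr rT M0 hM.
have hi := bounded_measurable_integrable bh s0 rT.
apply: (le_trans (le_normr_Rintegral _ hi)) => //.
have -> : M * (r - s) = \int[mu]_(v in `[s, r]) M.
  rewrite Rintegral_cst//= lebesgue_measure_itv/= lte_fin.
  by move: sr; rewrite le_eqVlt => /predU1P[->|->//]; rewrite ltxx subrr.
rewrite /Rintegral fine_le//.
- have : mu.-integrable `[s, r] (EFin \o (fun t => `|h t|)).
    exact: integrable_norm.
  exact: integrable_fin_num.
- apply: integrable_fin_num => //.
  have := bounded_measurable_integrable (bounded_measurable_cst M) s0 rT.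
  exact.
- apply: ae_ge0_le_integral => //.
  - apply/measurable_EFinP/measurableT_comp => //.
    by case/integrableP : hi => /measurable_EFinP.
Qed.

Lemma Rintegral_chasles h s r : bounded_measurable T h ->
  0 <= s -> s <= r -> r <= T ->
  \int[mu]_(v in `[0, r]) h v - \int[mu]_(v in `[0, s]) h v =
  \int[mu]_(v in `[s, r]) h v.
Proof.
move=> bh s0 sr rT.
have hi := bounded_measurable_integrable bh (lexx 0) rT.
rewrite Rintegral_itvB ?bnd_simp//.
rewrite Rintegral_itv_obnd_cbnd//.
apply: (@integrableS _ _ R mu _ _ _ _ _ _ hi) => //.
by apply: subset_itv; rewrite bnd_simp.
Qed.

Lemma Rintegral_fin_sum (I : finType) (h : I -> R -> R) s r :
  (forall i, bounded_measurable T (h i)) -> 0 <= s -> r <= T ->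
  \int[mu]_(v in `[s, r]) (\sum_i h i v) =
  \sum_i \int[mu]_(v in `[s, r]) h i v.
Proof.
move=> bh s0 rT.
pose P (e : seq I) := \int[mu]_(v in `[s, r]) (\sum_(i <- e) h i v) =
  \sum_(i <- e) \int[mu]_(v in `[s, r]) h i v.
suff : P (index_enum I) by [].
elim: (index_enum I) => [|i e IH]; rewrite /P.
  under eq_Rintegral do rewrite big_nil.
  by rewrite big_nil Rintegral_cst// mul0r.
under eq_Rintegral do rewrite big_cons.
rewrite big_cons RintegralD//; first by rewrite IH.
- exact: bounded_measurable_integrable.
(* [bounded_measurable_sum] runs over a finite type, so the list sum is re-indexed by positions in
   [e]. *)
- have -> : (fun v => \sum_(j <- e) h j v) =
      (fun v => \sum_(j < size e) h (tnth (in_tuple e) j) v).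
    by apply/funext => v; rewrite big_tnth.
  apply: bounded_measurable_integrable => //.
  exact: bounded_measurable_sum.
Qed.

(* [q] is only Lipschitz.  The increments of [r |-> q r * w r] minus the
   integral up to [r] are [O((r - s) ^ 2)], so this difference is constant. *)
Lemma integral_product_rule (q a w : R -> R) (q0 : R) : 0 <= T ->
  bounded_measurable T q -> bounded_measurable T a ->
  (forall r, r \in `[0, T] -> q r = q0 + \int[mu]_(v in `[0, r]) a v) ->
  C1_on T w ->
  q T * w T - q 0 * w 0 =
  \int[mu]_(v in `[0, T]) (q v * derive_on T w v + a v * w v).
Proof.
move=> T0 bq ba qE Cw.
have [dw cw'] := Cw.
have bw := bounded_measurable_continuous (derivable_on_continuous dw).
have bw' := bounded_measurable_continuous cw'.
have [W W0 w'W] := continuous_within_bounded cw'.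
have [A A0 aA] := essentially_bounded_pos ba.2.
set G := fun v => q v * derive_on T w v + a v * w v.
have bG : bounded_measurable T G.
  by apply: bounded_measurableD; apply: bounded_measurableM.
have inT (s r v : R) : 0 <= s -> r <= T -> v \in `[s, r] -> v \in `[0, T].
  by move=> s0 rT; rewrite !in_itv/= => /andP[sv vr];
    rewrite (le_trans s0)//= (le_trans vr).
have q_incr s r : 0 <= s -> s <= r -> r <= T ->
    q r - q s = \int[mu]_(v in `[s, r]) a v.
  move=> s0 sr rT; rewrite !qE ?in_itv/= ?s0 ?rT ?(le_trans s0 sr)//=;
    last exact: le_trans rT.
  by rewrite opprD addrACA subrr add0r Rintegral_chasles.
have q_lip s r : 0 <= s -> s <= r -> r <= T -> `|q r - q s| <= A * (r - s).
  move=> s0 sr rT; rewrite q_incr//; apply: le_norm_Rintegral_ae => //.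
  by apply: filterS aA => t H /(inT _ _ _ s0 rT); exact: H.
have w_lip s r : 0 <= s -> s <= r -> r <= T -> `|w r - w s| <= W * (r - s).
  move=> s0 sr rT; rewrite -(C1_on_FTC Cw)//; apply: le_norm_Rintegral_ae => //.
  by apply: aeW => t /(inT _ _ _ s0 rT); exact: w'W.
pose F r := q r * w r - \int[mu]_(v in `[0, r]) G v.
have : F T = F 0.
  apply: (@quadratic_increments_constant _ _ (2 * A * W)) => // s r s0 sr rT.
  (* The increment of [q * w] is [w r * (q r - q s) + q s * (w r - w s)], and both differences are
     integrals. Subtracting [G] pairs [a] with an increment of [w] and the derivative of [w] with an
     increment of [q]; each pair is at most [A * W * (r - s)], whence the constant [2 * A * W]. *)
  have FE : F r - F s = \int[mu]_(v in `[s, r])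
      (a v * (w r - w v) + derive_on T w v * (q s - q v)).
    have -> : F r - F s = (\int[mu]_(v in `[s, r]) (w r * a v) +
        \int[mu]_(v in `[s, r]) (q s * derive_on T w v)) -
        \int[mu]_(v in `[s, r]) G v.
      rewrite !RintegralZl//; [|exact: bounded_measurable_integrable..].
      rewrite -q_incr// C1_on_FTC// -Rintegral_chasles// /F.
      ring.
    rewrite -RintegralD//; first rewrite -RintegralB//.
    - apply: eq_Rintegral => v _; rewrite /G; ring.
    - apply: (bounded_measurable_integrable _ s0 rT).
      by apply: bounded_measurableD; apply: bounded_measurableM => //;
        exact: bounded_measurable_cst.
    - exact: bounded_measurable_integrable.
    - apply: (bounded_measurable_integrable _ s0 rT).
      by apply: bounded_measurableM => //; exact: bounded_measurable_cst.
    - apply: (bounded_measurable_integrable _ s0 rT).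
      by apply: bounded_measurableM => //; exact: bounded_measurable_cst.
  rewrite FE; have -> : 2 * A * W * (r - s) ^+ 2 =
    (2 * A * W * (r - s)) * (r - s) by ring.
  apply: le_norm_Rintegral_ae => //.
  - apply: bounded_measurableD; apply: bounded_measurableM => //;
    apply: bounded_measurableD; rewrite //; try exact: bounded_measurable_cst;
    exact: bounded_measurableN.
  - by rewrite !mulr_ge0// subr_ge0.
  - apply: filterS aA => v H vsr.
    have vT := inT _ _ _ s0 rT vsr.
    move: (vsr); rewrite in_itv/= => /andP[sv vr].
    have -> : 2 * A * W * (r - s) = A * (W * (r - s)) + W * (A * (r - s)).
      by ring.
    rewrite (le_trans (ler_normD _ _))// !normrM; apply: lerD.
      apply: ler_pM => //; first exact: H.
      apply: (le_trans (w_lip v r _ _ _)) => //; first exact: le_trans sv.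
      by rewrite ler_wpM2l// lerD2l lerN2.
    apply: ler_pM => //; first exact: w'W.
    rewrite distrC; apply: (le_trans (q_lip s v _ _ _)) => //.
      exact: le_trans rT.
    by rewrite ler_wpM2l// lerD2r.
rewrite /F set_itv1 Rintegral_set1 subr0 => <-.
by rewrite opprB addrC subrK.
Qed.

End bounded_measurable_theory.

(** * Rate matrices and the forward equation *)

Section rate_matrix_theory.
Context (R : realType) (N : nat) (V : 'I_N -> {set 'I_N}).
Hypothesis V_irrefl : forall i, i \notin V i.
Implicit Types (l : 'I_N -> 'I_N -> R).

Lemma rate_matrix_neq l j k : j != k ->
  rate_matrix V l j k = if k \in V j then l j k else 0.
Proof. by move=> jk; rewrite mxE (negbTE jk). Qed.

(** The diagonal entry carries the outflow, and [i \notin V i] keeps it from mixing with the inflow.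
    This puts the equation for [m] in the form [m' = m Q]. *)
Lemma rate_matrix_forward l (x : 'I_N -> R) i :
  \sum_j x j * rate_matrix V l j i =
  \sum_(j | i \in V j) l j i * x j - \sum_(j in V i) l i j * x i.
Proof.
rewrite (bigD1 i)//= {1}mxE eqxx mulrN addrC; congr (_ - _); last first.
  by rewrite mulr_sumr; apply: eq_bigr => j _; rewrite mulrC.
rewrite [RHS]big_mkcond [RHS](bigD1 i)//= (negbTE (V_irrefl i)) add0r.
apply: eq_bigr => j ji; rewrite rate_matrix_neq//.
by case: ifP => _; rewrite ?mulr0// mulrC.
Qed.

(** The generator acts on [w] through differences only; this is how the arguments [diffs] of the
    Hamiltonian arise. *)
Lemma rate_matrix_backward l (w : 'I_N -> R) j :
  \sum_k rate_matrix V l j k * w k = \sum_(k in V j) l j k * (w k - w j).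
Proof.
rewrite (bigD1 j)//= {1}mxE eqxx mulNr addrC.
under [RHS]eq_bigr do rewrite mulrBr.
rewrite big_split/= sumrN mulr_suml; congr (_ - _).
rewrite [RHS]big_mkcond [RHS](bigD1 j)//= (negbTE (V_irrefl j)) add0r.
apply: eq_bigr => k kj; rewrite rate_matrix_neq 1?eq_sym//.
by case: ifP => _; rewrite ?mul0r.
Qed.

Lemma rate_matrix_row_sum l j : \sum_k rate_matrix V l j k = 0.
Proof.
have := rate_matrix_backward l (fun=> 1) j.
under eq_bigr do rewrite mulr1.
by move=> ->; rewrite big1// => k _; rewrite subrr mulr0.
Qed.

Lemma bounded_measurable_rate_matrix (T : R) (lam : R -> 'I_N -> 'I_N -> R) j k :
  (forall i j, j \in V i -> bounded_measurable T (fun t => lam t i j)) ->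
  bounded_measurable T (fun t => rate_matrix V (lam t) j k).
Proof.
move=> blam; have [<-|jk] := eqVneq j k.
  under eq_fun do rewrite mxE eqxx.
  apply: bounded_measurableN; apply: bounded_measurable_sum => i; exact: blam.
under eq_fun do rewrite rate_matrix_neq//.
case: (boolP (k \in V j)) => [|_]; first exact: blam.
exact: bounded_measurable_cst.
Qed.

End rate_matrix_theory.

Lemma left_difference_quotient_gt (R : realType) (T : R) (h : R -> R)
    (t c d : R) :
  derivable_on T h -> 0 < t -> t <= T -> c < derive_on T h t -> 0 < d ->
  exists s, [/\ 0 <= s, s < t, t - s <= d & c < dquot h t s].
Proof.
move=> dh t0 tT cd d0.
have tT' : t \in `[0, T] by rewrite in_itv/= (ltW t0).
have gap : 0 < derive_on T h t - c by rewrite subr_gt0.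
have /nbhs_ballP[e /= e0 He] := derive_on_near dh tT' gap.
(* [e / 2] keeps [t - r] strictly inside the ball, [t] keeps it nonnegative, and [d] is the
   prescribed distance. *)
pose r := Num.min (e / 2) (Num.min t d).
have r0 : 0 < r by rewrite !lt_min divr_gt0//= t0.
have rt : r <= t by rewrite !ge_min lexx !orbT.
have rd : r <= d by rewrite !ge_min lexx !orbT.
have re : r < e.
  rewrite (@le_lt_trans _ _ (e / 2))//; first by rewrite ge_min lexx.
  by rewrite ltr_pdivrMr// ltr_pMr// ltr1n.
exists (t - r); split.
- by rewrite subr_ge0.
- by rewrite ltrBlDr ltrDl.
- by rewrite opprB addrC subrK.
- have := He (t - r); rewrite /ball/= opprB addrC subrK gtr0_norm// => /(_ re).
  rewrite in_itv/= subr_ge0 rt/= (le_trans _ tT) ?lerBlDr ?lerDl ?(ltW r0)//.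
  have -> : (t - r != t) by rewrite -subr_eq0 addrAC subrr add0r oppr_eq0 gt_eqF.
  move=> /(_ isT isT); rewrite ltr_norml => /andP[_].
  by rewrite ltrD2l ltrN2.
Qed.

(* Otherwise some [m s i * expR (- C * s)] has a negative minimum over [i] and
   [s].  It is attained at a time [s > 0], where the minimality forces a left
   derivative of [m i] too small for the equation when [C] is large. *)
Lemma forward_equation_ge0 (R : realType) (N : nat) (T K : R)
    (Q : R -> 'M[R]_N) (m : R -> 'I_N -> R) :
  0 <= K ->
  (forall i, derivable_on T (m ^~ i)) ->
  (forall t i, t \in `[0, T] ->
    derive_on T (m ^~ i) t = \sum_j m t j * Q t j i) ->
  (forall t i j, t \in `[0, T] -> Q t j i <= K) ->
  (forall t i j, t \in `[0, T] -> j != i -> 0 <= Q t j i) ->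
  (forall i, 0 <= m 0 i) ->
  forall t i, t \in `[0, T] -> 0 <= m t i.
Proof.
move=> K0 dm mE QK Q0 m0 t0 i0 t0T.
pose B := \sum_(j < N) K.
have B0 : 0 <= B by apply: sumr_ge0.
(* [B] is [N * K], and the derivative at the minimum will be at least [- a * B]. The summand 1 makes
   this strict, and the factor 2 pays for replacing [expR (- x)] by [1 - x / 2] at the end. *)
pose C := 2 * (B + 1).
have C0 : 0 < C by rewrite mulr_gt0// ltr_wpDl.
have T0 : 0 <= T by move: t0T; rewrite in_itv/= => /andP[]; exact: le_trans.
pose A i t := - (m t i * expR (- C * t)).
have cA i : {within `[0, T], continuous (A i)}.
  apply/subspace_continuousP => t tT; apply: cvgN; apply: cvgM.
    by have /subspace_continuousP := derivable_on_continuous (dm i); exact.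
  apply: cvg_within_filter.
  have : continuous (fun t : R => expR (- C * t)).
    move=> x; apply: (@continuous_comp _ _ _ (fun t => - C * t) expR).
      exact: mulrl_continuous.
    exact: continuous_expR.
  exact.
have /choice[c Hc] : forall i, exists c, c \in `[0, T] /\
    forall t, t \in `[0, T] -> A i t <= A i c.
  by move=> i; have [c cT Hc] := EVT_max T0 (cA i); exists c.
pose i := [arg max_(i > i0) A i (c i)]%O.
have iP j : A j (c j) <= A i (c i).
  by rewrite /i; case: Order.TotalTheory.arg_maxP => // k _; exact.
have {iP}AP j t : t \in `[0, T] -> A j t <= A i (c i).
  by move=> tT; apply: le_trans (iP j); case: (Hc j) => _; exact.
have tT : c i \in `[0, T] by case: (Hc i).
move: i (c i) tT AP => i t tT AP {Hc c}.
rewrite leNgt; apply/negP => mneg.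
have mt : m t i < 0.
  rewrite ltNge; apply/negP => mt.
  have := AP i0 _ t0T; rewrite /A lerN2 leNgt => /negP; apply.
  by rewrite (@lt_le_trans _ _ 0) ?nmulr_rlt0 ?expR_gt0// mulr_ge0// expR_ge0.
have lower j s : s \in `[0, T] -> m t i * expR (- C * (t - s)) <= m s j.
  move=> sT; have := AP j s sT; rewrite /A lerN2.
  have e0 := expR_gt0 (- C * s).
  have -> : - C * t = - C * (t - s) + - C * s by ring.
  by rewrite expRD mulrA ler_pM2r.
have [a mtE] : exists a, m t i = - a by exists (- m t i); rewrite opprK.
have a0 : 0 < a by move: mt; rewrite mtE oppr_lt0.
have tpos : 0 < t.
  rewrite lt_neqAle eq_sym; move: tT; rewrite in_itv/= => /andP[-> _].
  rewrite andbT; apply/eqP => t00; move: mt; rewrite t00 ltNge.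
  by rewrite m0.
have tleT : t <= T by move: tT; rewrite in_itv/= => /andP[].
have mlow j : - a <= m t j.
  by have := lower j t tT; rewrite subrr mulr0 expR0 mulr1 mtE.
(* Off the diagonal [Q t j i >= 0], so [m t j >= - a] survives the multiplication. The diagonal
   entry may have either sign, but there [m t i] equals [- a] exactly. *)
have deriv : - a * B <= derive_on T (m ^~ i) t.
  rewrite mE// mulr_sumr; apply: ler_sum => j _.
  have [->|ji] := eqVneq j i.
    rewrite mtE !mulNr lerN2.
    by rewrite ler_wpM2l ?(ltW a0)// QK.
  apply: (@le_trans _ _ (- a * Q t j i)); last by rewrite ler_wpM2r ?Q0.
  by rewrite !mulNr lerN2 ler_wpM2l ?(ltW a0)// QK.
have deriv' : - a * (B + 1) < derive_on T (m ^~ i) t.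
  apply: lt_le_trans deriv; rewrite mulrDr mulr1.
  by rewrite gtrDl oppr_lt0.
have Ci0 : 0 < C^-1 by rewrite invr_gt0.
have [s [s0 st Cst]] := left_difference_quotient_gt (dm i) tpos tleT deriv' Ci0.
apply/negP; rewrite -leNgt.
have sT : s \in `[0, T] by rewrite in_itv/= s0 (le_trans (ltW st)).
have := lower i s sT; set y := expR _ => Hy.
have ts0 : 0 < t - s by rewrite subr_gt0.
pose x := C * (t - s).
have x0 : 0 < x by rewrite mulr_gt0.
have x1 : x <= 1 by rewrite /x mulrC -ler_pdivlMr// div1r.
have y0 : 0 < y by exact: expR_gt0.
have yx : y * (1 + x) <= 1.
  have yE : y * expR x = 1 by rewrite /y mulNr mulrC expRxMexpNx_1.
  by rewrite -[leRHS]yE ler_pM2l// expR_ge1Dx.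
(* [1 / (1 + x) <= 1 - x / 2] holds for [0 <= x <= 1]; this is why [s] was taken within [C^-1] of
   [t]. *)
have yx' : y <= 1 - x / 2 by nra.
rewrite /dquot -(opprB t s) invrN !mulNr lerN2 [leRHS]mulrC ler_pdivlMr//.
have -> : a * (B + 1) * (t - s) = a * (x / 2) by rewrite /x /C; field.
have {}Hy : - a * y <= m s i by rewrite -mtE.
rewrite mtE opprK; nra.
Qed.

(** * Composition with a function continuous on the orthant *)

Section discretization.
Context (R : realType) (d : nat).

(** Indices are natural numbers: the grid points then stay in the orthant, and the index type is
    countable. *)
Definition grid_point (n : nat) (z : {ffun 'I_d -> nat}) : 'rV[R]_d :=
  \row_k ((z k)%:R / n.+1%:R).

Definition grid_index (n : nat) (x : 'rV[R]_d) : {ffun 'I_d -> nat} :=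
  [ffun k => Num.truncn (x 0 k * n.+1%:R)].

Lemma orthant_grid_point n z : orthant (grid_point n z).
Proof. by move=> k; rewrite mxE divr_ge0. Qed.

Lemma grid_point_cvg (x : 'rV[R]_d) : orthant x ->
  grid_point n (grid_index n x) @[n --> \oo] --> x.
Proof.
move=> x0; apply: row_cvg => k; apply/cvgrPdist_le => e e0.
near=> n.
have n0 : (0 : R) < n.+1%:R by rewrite ltr0n.
have xn0 : 0 <= x 0 k * n.+1%:R by rewrite mulr_ge0.
have /andP[lo hi] := truncn_itv xn0.
rewrite !mxE ffunE.
have lo' : (Num.truncn (x 0 k * n.+1%:R))%:R / n.+1%:R <= x 0 k.
  by rewrite ler_pdivrMr.
rewrite ger0_norm ?subr_ge0//.
apply: (@le_trans _ _ n.+1%:R^-1).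
  rewrite lerBlDr -[X in X + _]mul1r -mulrDl ler_pdivlMr// addrC.
  by rewrite natr1 ltW.
near: n.
have [k0 _ Hk] := near_infty_natSinv_lt (PosNum e0).
by exists k0 => // n /Hk /= /ltW.
Unshelve. all: by end_near.
Qed.

(* ['rV[R]_d] carries no sigma-algebra here, so [L \o h] is obtained as the
   pointwise limit of [L] along grid approximations of [h], which take
   countably many values and stay in the orthant, where [L] is continuous. *)
Lemma measurable_orthant_continuous (D : set R) (L : 'rV[R]_d -> R)
    (h : R -> 'rV[R]_d) : measurable D ->
  {within @orthant R d, continuous L} ->
  (forall k, measurable_fun D (fun t => h t 0 k)) ->
  (forall t, D t -> orthant (h t)) ->
  measurable_fun D (fun t => L (h t)).
Proof.
move=> mD cL mh h0.
apply: (@measurable_fun_cvg _ _ _ _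
  (fun n t => L (grid_point n (grid_index n (h t))))); last first.
  move=> t Dt; move/subspace_continuousP : cL => /(_ _ (h0 t Dt)) cL.
  move=> G GL; have /= nb := grid_point_cvg (h0 t Dt) (cL G GL).
  have {}nb : \forall n \near \oo,
      G (L (grid_point n (grid_index n (h t)))).
    have {}nb : \forall n \near \oo, orthant (grid_point n (grid_index n (h t)))
      -> G (L (grid_point n (grid_index n (h t)))) by exact: nb.
    by apply: filterS nb => n; apply; exact: orthant_grid_point.
  exact: nb.
move=> n _ Y mY.
(* [E z] gathers the times whose grid index is [z], with the truncation unfolded into inequalities
   on coordinates. It is empty when the value of [L] at that grid point misses [Y]. *)
pose E z := [set t | Y (L (grid_point n z)) /\
  (D t /\ forall k, (z k)%:R <= h t 0 k * n.+1%:R < (z k).+1%:R)].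
have -> : D `&` (fun t => L (grid_point n (grid_index n (h t)))) @^-1` Y =
    \bigcup_z E z.
  apply/seteqP; split => [t [Dt Yt]|t [z _ [Yz [Dt zt]]]].
    exists (grid_index n (h t)) => //; split => //; split => // k.
    by rewrite ffunE truncn_itv// mulr_ge0//; exact: h0.
  split => //=; suff -> : grid_index n (h t) = z by [].
  by apply/ffunP => k; rewrite ffunE; apply: truncn_def.
apply: countable_bigcupT_measurable => [|z]; first exact: countableP.
have [Yz|Yz] := pselect (Y (L (grid_point n z))); last first.
  rewrite (_ : E z = set0)//; apply/seteqP; split => // t [].
  by move=> /Yz.
have -> : E z = D `&` \bigcap_(k in setT) (D `&` (fun t => h t 0 k) @^-1`
    `[(z k)%:R / n.+1%:R, (z k).+1%:R / n.+1%:R[).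
  apply/seteqP; split => [t [_ [Dt zt]]|t [Dt zt]].
    split => // k _; split => //=.
    by rewrite in_itv/= ler_pdivrMr// ltr_pdivlMr.
  split => //; split => // k; have [_ /=] := zt k I.
  by rewrite in_itv/= ler_pdivrMr// ltr_pdivlMr.
apply: measurableI => //; apply: fin_bigcap_measurable => // k _.
exact: mh.
Qed.
End discretization.

Lemma essentially_bounded_family (R : realType) (T : R) (I : finType)
    (h : I -> R -> R) : (forall i, essentially_bounded T (h i)) ->
  exists2 M, 0 <= M & {ae lebesgue_measure, forall t, t \in `[0, T] ->
    forall i, `|h i t| <= M}.
Proof.
move=> bh.
have /choice[M HM] : forall i, exists M, 0 <= M /\
    {ae lebesgue_measure, forall t, t \in `[0, T] -> `|h i t| <= M}.
  by move=> i; have [M M0 hM] := essentially_bounded_pos (bh i); exists M.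
exists (\sum_i M i); first by apply: sumr_ge0 => i _; case: (HM i).
have : \forall t \ae (@lebesgue_measure R), forall i,
    t \in `[0, T] -> `|h i t| <= M i.
  apply: (@filter_forall _ _ (fun i t => t \in `[0, T] -> `|h i t| <= M i) _
    (lebesgue_ae_filter R)) => i.
  by case: (HM i).
apply: filterS => t H tT i; apply: (le_trans (H i tT)).
rewrite (bigD1 i)//= lerDl; apply: sumr_ge0 => j _; by case: (HM j).
Qed.

(** For almost every time [h t] lies in a fixed cube [[0, M]^d], a compact part of the orthant, on
    which [L] is bounded. *)
Lemma bounded_measurable_orthant_continuous (R : realType) (T : R) (d : nat)
    (L : 'rV[R]_d -> R) (h : R -> 'rV[R]_d) :
  {within @orthant R d, continuous L} ->
  (forall k, bounded_measurable T (fun t => h t 0 k)) ->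
  (forall t, t \in `[0, T] -> orthant (h t)) ->
  bounded_measurable T (fun t => L (h t)).
Proof.
move=> cL bh h0; split.
  apply: (@measurable_orthant_continuous _ _ `[0, T]) => // k.
  by case: (bh k).
have [M M0 hM] := essentially_bounded_family (fun k => (bh k).2).
pose B := [set v : 'rV[R]_d | forall k, `[0, M]%classic (v ord0 k)].
have Bc : compact B.
  by apply: (@rV_compact R _ (fun=> `[0, M]%classic)) => k; exact: segment_compact.
have cB : {within B, continuous L}.
  apply: continuous_subspaceW cL => v Bv k.
  by have := Bv k; rewrite /= in_itv => /andP[].
have := continuous_compact cB Bc; move/compact_bounded => [A [_ /(_ (`|A| + 1))]].
rewrite (le_lt_trans (ler_norm _)) ?ltrDl// => /(_ isT) HA.
exists (`|A| + 1); apply: filterS hM => t H tT; apply: HA => /=.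
exists (h t) => // k; rewrite /= in_itv/= h0//=.
exact: le_trans (ler_norm _) (H tT k).
Qed.

(** * Payoffs along a Markov chain *)

(* [X s w] is the eventual value of [X] at the first point of the grid of mesh
   [1 / n.+1] after [s], by right continuity. *)
Lemma right_continuous_jointly_measurable (R : realType) (T : R)
    (d : measure_display) (Om : measurableType d) (St : Type)
    (X : R -> Om -> St) (k : St) :
  0 <= T ->
  (forall s, s \in `[0, T] -> measurable [set w | X s w = k]) ->
  (forall w s, s \in `[0, T[ -> \forall r \near s^'+, X r w = X s w) ->
  measurable [set z : R * Om | z.1 \in `[0, T] /\ X z.1 z.2 = k].
Proof.
move=> T0 mX rcX.
(* The cap at [T] keeps the sampling times in [[0, T]] and settles [s = T], where right continuity
   says nothing: there [next n j] is [T] itself. *)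
pose next n j : R := Num.min T (j.+1%:R / n.+1%:R).
pose cell n j : set R := `[0, T] `&` `[j%:R / n.+1%:R, j.+1%:R / n.+1%:R[.
pose F n : set (R * Om) := \bigcup_j (cell n j `*` [set w | X (next n j) w = k]).
have next_in n j : next n j \in `[0, T].
  by rewrite in_itv/= ge_min lexx/= le_min T0 divr_ge0.
have next_near s w : s \in `[0, T] ->
    \forall n \near \oo, forall j, cell n j s -> X (next n j) w = X s w.
  rewrite in_itv/= => /andP[s0]; rewrite le_eqVlt => /predU1P[->|sT].
    apply: nearW => n j [_ /=]; rewrite in_itv/= => /andP[_ Tj].
    by rewrite /next min_l// ltW.
  have sT' : s \in `[0, T[ by rewrite in_itv/= s0.
  have [e /= e0 He] := rcX w s sT'.
  have [n0 _ Hn0] := near_infty_natSinv_lt (PosNum e0).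
  exists n0 => // n /Hn0 /= ne j [_ /=]; rewrite in_itv/= => /andP[js sj].
  have snext : s < next n j by rewrite lt_min sT.
  apply: He => //=; rewrite distrC gtr0_norm ?subr_gt0// ltrBlDr.
  apply: (@le_lt_trans _ _ (j.+1%:R / n.+1%:R)); first by rewrite ge_min lexx orbT.
  rewrite -natr1 mulrDl mul1r addrC; apply: ltr_leD => //.
have cellE n s : s \in `[0, T] -> exists j, cell n j s.
  move=> sT; exists (Num.truncn (s * n.+1%:R)); split => //=.
  rewrite in_itv/= ler_pdivrMr// ltr_pdivlMr//; apply: truncn_itv.
  by rewrite mulr_ge0//; move: sT; rewrite in_itv/= => /andP[].
(* The event is the lower limit of the sets [F n]. Conversely, for large [n] the sampled value is
   both [k] and [X s w]. *)
have -> : [set z : R * Om | z.1 \in `[0, T] /\ X z.1 z.2 = k] =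
    \bigcup_n0 \bigcap_n F (n0 + n)%N.
  apply/seteqP; split => [[s w] /= [sT Xk]|[s w] [n0 _ Hn]].
    have [n0 _ Hn0] := next_near s w sT.
    exists n0 => // n _; have [j Hj] := cellE (n0 + n)%N s sT.
    exists j => //; split => //=.
    by rewrite (Hn0 (n0 + n)%N _ j Hj)//= leq_addr.
  have [j0 _ [[sT _] _]] := Hn 0%N I; split => //=.
  have [n1 _ Hn1] := next_near s w sT.
  have [j _ [/= Hj <-]] := Hn n1 I.
  by rewrite (Hn1 (n0 + n1)%N _ j Hj)//= leq_addl.
apply: bigcupT_measurable => n0; apply: bigcapT_measurable => n.
apply: bigcupT_measurable => j; apply: measurableX; last exact: mX.
exact: measurableI.
Qed.

Section occupation.
Context (R : realType) (T : R) (d : measure_display) (Om : measurableType d).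
Context (P : probability Om R) (E : set (R * Om)) (phi : R -> R).
Hypotheses (mE : measurable E) (bphi : bounded_measurable T phi).
Local Notation mu := (@lebesgue_measure R).

Lemma bounded_measurable_section w :
  bounded_measurable T (fun s => phi s * \1_E (s, w)).
Proof.
apply: bounded_measurableM => //; split.
  have /measurable_funTS : measurable_fun setT (fun s => \1_E (s, w) : R).
    by apply: measurable_fun_pair1; exact: measurable_indic.
  exact.
by exists 1; apply: aeW => t _; rewrite indicE; case: (_ \in _);
  rewrite ?normr1 ?normr0.
Qed.

(** Extending [phi] by zero off [[0, T]] lets Fubini be applied on the whole product space. *)
Let F (z : R * Om) : \bar R := (((phi \_ `[0, T]) z.1 * \1_E z)%:E)%E.

Let mF : measurable_fun setT F.
Proof.
apply/measurable_EFinP; apply: measurable_funM; last exact: measurable_indic.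
apply: measurableT_comp; last exact: measurable_fst.
have mI : measurable (`[0, T]%classic : set R) by exact: measurable_itv.
by apply: (measurable_restrictT phi mI).1; case: bphi.
Qed.

Let F_inner s : (\int[P]_w F (s, w) =
  ((phi \_ `[0, T]) s * fine (P (xsection E s)))%:E)%E.
Proof.
have mx : measurable (xsection E s) by exact: measurable_xsection.
under eq_integral do rewrite /F/= EFinM.
have -> : (fun w => ((phi \_ `[0, T]) s)%:E * (\1_E (s, w))%:E)%E =
    (fun w => ((phi \_ `[0, T]) s)%:E * (\1_(xsection E s) w)%:E)%E.
  by apply/funext => w; rewrite !indicE mem_xsection.
rewrite integralZl//.
  by rewrite integral_indic// setIT EFinM fineK// fin_num_measure.
exact: integrable_indic.
Qed.

(** [P] has total mass 1, so the inner integral of [|F (s, w)|] is at most [|phi s|] on [[0, T]],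
    and 0 elsewhere. *)
Let F_int : ((mu : {sigma_finite_measure set (measurableTypeR R) -> \bar R})
   \x P)%E.-integrable setT F.
Proof.
apply/integrable12ltyP => //.
pose absF (s : R) := ((`|(phi \_ `[0%R, T]) s|)%:E)%E.
have iphi : mu.-integrable setT absF.
  have int := bounded_measurable_integrable bphi (lexx 0) (lexx T).
  have := (@integrable_mkcond _ _ R mu _ (EFin \o phi) (measurable_itv `[0, T])).1 int.
  move/integrable_abse; apply: eq_integrable => // s _.
  by rewrite /absF /patch /=; case: ifP.
apply: le_lt_trans (integrable_lty _ iphi) => //.
apply: ge0_le_integral => //.
- by move=> s _; apply: integral_ge0.
- have mF' : measurable_fun setT (abse \o F) by exact: measurableT_comp.
  exact: (@measurable_fun_fubini_tonelli_F _ _ _ _ R P _ mF'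
    (fun z => abse_ge0 (F z))).
- by case/integrableP: iphi.
move=> s _; rewrite -[leRHS]mule1 -(probability_setT P).
rewrite -integral_cst//; apply: ge0_le_integral => //.
- by apply: measurableT_comp => //; exact: measurable_fun_pair2.
move=> w _; rewrite /F /absF /= lee_fin normrM ler_piMr//.
by rewrite indicE; case: (_ \in _); rewrite ?normr1 ?normr0.
Qed.

Let F_outer w : (\int[mu]_s F (s, w) =
  (\int[mu]_(s in `[0%R, T]) (phi s * \1_E (s, w))%R)%:E)%E.
Proof.
have int := bounded_measurable_integrable (bounded_measurable_section w)
  (lexx 0) (lexx T).
rewrite /Rintegral fineK; last exact: integrable_fin_num.
rewrite [RHS]integral_mkcond; apply: eq_integral => s _.
by rewrite /F /patch /=; case: ifP; rewrite ?mul0r.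
Qed.

Lemma occupation_integrable :
  P.-integrable setT (EFin \o
    (fun w => \int[mu]_(s in `[0, T]) (phi s * \1_E (s, w)))).
Proof.
have iphi := bounded_measurable_integrable bphi (lexx 0) (lexx T).
apply: measurable_bounded_integrable => //.
- by apply: (@le_lt_trans _ _ 1%E); [exact: probability_le1|exact: ltry].
- apply/measurable_EFinP; apply: eq_measurable_fun (measurable_fubini_G F_int).
  by move=> w _; exact: F_outer.
- exists (\int[mu]_(s in `[0, T]) `|phi s|); split; first exact: num_real.
  move=> M /ltW CM w _ /=; apply: le_trans CM.
  have isec := bounded_measurable_integrable (bounded_measurable_section w)
    (lexx 0) (lexx T).
  apply: (le_trans (le_normr_Rintegral _ isec)) => //.
  apply: le_Rintegral => //.
  + exact: (@integrable_norm _ _ R mu _ _ isec).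
  + exact: (@integrable_norm _ _ R mu _ _ iphi).
  + move=> s _; rewrite normrM ler_piMr// indicE.
    by case: (_ \in _); rewrite ?normr1 ?normr0.
Qed.

(** Fubini, with [P] integrated first: the indicator becomes the probability of the time section.
    For [E] the event [X s = k] this is the law of the chain at time [s]. *)
Lemma expectation_occupation :
  (\int[P]_w (\int[mu]_(s in `[0%R, T]) (phi s * \1_E (s, w))%R)%:E =
  (\int[mu]_(s in `[0%R, T]) (phi s * fine (P (xsection E s)))%R)%:E)%E.
Proof.
under eq_integral do rewrite -F_outer.
rewrite -(Fubini F_int); under eq_integral do rewrite F_inner.
rewrite /Rintegral fineK.
  rewrite [RHS]integral_mkcond; apply: eq_integral => s _.
  by rewrite /patch /=; case: ifP; rewrite ?mul0r.
apply: integrable_fin_num => //.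
apply: (@integrable_mkcond _ _ R mu _ _ (measurable_itv `[0, T])).2.
have := integrable_fubini_F F_int; apply: eq_integrable => // s _.
rewrite /fubini_F F_inner /patch /=; case: ifP; rewrite ?mul0r//.
Qed.

End occupation.

Lemma probability_setI_full (R : realType) (d : measure_display)
    (Om : measurableType d) (P : probability Om R) (A B : set Om) :
  measurable A -> measurable B -> P A = 1%E -> P (A `&` B) = P B.
Proof.
move=> mA mB PA; suff PBA : P (B `\` A) = 0%E.
  rewrite setIC [RHS](measureDI P mB mA).
  by rewrite [X in _ = (X + _)%E]PBA add0e.
apply/eqP; rewrite -measure_le0.
apply: (@le_trans _ _ (P (~` A))); last first.
  by rewrite [leLHS]probability_setC// PA subee.
apply: le_measure; rewrite ?inE; [exact: measurableD|exact: measurableC|].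
by move=> w [].
Qed.

Section payoff.
Context (R : realType) (N : nat) (V : 'I_N -> {set 'I_N}) (T : R).
Context (d : measure_display) (Om : measurableType d) (P : probability Om R).
Context (X : R -> Om -> 'I_N) (i : 'I_N) (lam : R -> 'I_N -> 'I_N -> R).
Hypothesis T0 : 0 <= T.
Hypothesis chain : markov_chain V 0 T i lam P X.
Local Notation mu := (@lebesgue_measure R).

Lemma markov_chain_marginal : exists p, transition_function V 0 T lam p /\
  forall r k, r \in `[0, T] -> P [set w | X r w = k] = (p 0 r i k)%:E.
Proof.
have [mX _ X0 [p [tp Hp]]] := chain.
exists p; split => // r k; rewrite in_itv/= => /andP[r0 rT].
have := Hp 0 r [::] i k (lexx 0) r0 rT (fun _ => ltac:(by [])).
have -> : [set w | (forall c, c \in [::] -> X c.1 w = c.2) /\ X 0 w = i] =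
    [set w | X 0 w = i] by apply/seteqP; split => [w []|w].
rewrite X0 mul1e => <-.
rewrite -(@probability_setI_full _ _ _ P [set w | X 0 w = i]) ?X0//.
- by congr (P _); apply/seteqP; split => [w []|w []].
- by apply: mX; rewrite in_itv/= lexx.
- by apply: mX; rewrite in_itv/= r0.
Qed.

(** Decompose both the running and the terminal payoff over the indicators of [X s = k]; exactly one
    of them is 1 at each time, and each summand is an occupation integral. *)
Lemma expectation_running_terminal (phi : 'I_N -> R -> R) (gam : 'I_N -> R)
    (q : R -> 'I_N -> R) :
  (forall k, bounded_measurable T (phi k)) ->
  (forall r k, r \in `[0, T] -> P [set w | X r w = k] = (q r k)%:E) ->
  (forall k, bounded_measurable T (q ^~ k)) ->
  expectation P (fun w => \int[mu]_(s in `[0, T]) phi (X s w) s + gam (X T w))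
  = (\int[mu]_(s in `[0, T]) (\sum_k q s k * phi k s)
     + \sum_k q T k * gam k)%:E.
Proof.
move=> bphi qE bq.
have [mX rcX _ _] := chain.
have TT : T \in `[0, T] by rewrite in_itv/= lexx T0.
pose E k := [set z : R * Om | z.1 \in `[0, T] /\ X z.1 z.2 = k].
have mE k : measurable (E k).
  apply: right_continuous_jointly_measurable => // [s sT|w s sT]; first exact: mX.
  by have [H _] := rcX w; exact: H.
pose Y k w := \int[mu]_(s in `[0, T]) (phi k s * \1_(E k) (s, w)).
pose Z k w : R := gam k * \1_[set w | X T w = k] w.
have iY k : P.-integrable setT (EFin \o Y k) by exact: occupation_integrable.
have iZ k : P.-integrable setT (EFin \o Z k).
  apply: (@integrableZl _ _ R P _ measurableT (gam k)
    (EFin \o \1_[set w | X T w = k])).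
  apply: integrable_indic => //; exact: mX.
have -> : (fun w => \int[mu]_(s in `[0, T]) phi (X s w) s + gam (X T w)) =
    (fun w => \sum_k Y k w + \sum_k Z k w).
  apply/funext => w; congr (_ + _).
    rewrite -(@Rintegral_fin_sum _ T)//; last first.
      by move=> k; exact: bounded_measurable_section.
    apply: eq_Rintegral => s; rewrite inE/= => sT.
    rewrite (bigD1 (X s w))//= big1 ?addr0.
      by rewrite indicE mem_set ?mulr1.
    move=> k kX; rewrite indicE memNset ?mulr0// => -[_ /= XE].
    by rewrite XE eqxx in kX.
  rewrite (bigD1 (X T w))//= big1 ?addr0.
    by rewrite /Z indicE mem_set ?mulr1.
  move=> k kX; rewrite /Z indicE memNset ?mulr0// => /= XE.
  by rewrite XE eqxx in kX.
rewrite expectation.unlock.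
have sumE (h : 'I_N -> Om -> R) : (forall k, P.-integrable setT (EFin \o h k)) ->
    P.-integrable setT (EFin \o (fun w => \sum_k h k w)) /\
    (\int[P]_w (\sum_k h k w)%:E = \sum_k \int[P]_w (h k w)%:E)%E.
  move=> ih; split.
    have -> : EFin \o (fun w => \sum_k h k w) =
        (fun w => (\sum_k (EFin \o h k) w)%E).
      by apply/funext => w; rewrite /= -sumEFin.
    exact: integrable_sum.
  under eq_integral do rewrite -sumEFin.
  exact: (@integral_sum _ _ R P _ measurableT _ (fun k w => (h k w)%:E)).
have [isY EY] := sumE _ iY; have [isZ EZ] := sumE _ iZ.
rewrite integralD_EFin// EY EZ EFinD; congr (_ + _)%E.
  rewrite (@Rintegral_fin_sum _ T)//; last first.
    by move=> k; exact: bounded_measurableM.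
  rewrite -sumEFin; apply: eq_bigr => k _.
  rewrite expectation_occupation//; congr EFin.
  apply: eq_Rintegral => s; rewrite inE/= => sT.
  have -> : xsection (E k) s = [set w | X s w = k].
    by apply/seteqP; split => w; rewrite /xsection /E/= inE/=; [case|].
  by rewrite qE// mulrC.
rewrite -sumEFin; apply: eq_bigr => k _.
rewrite /Z; under eq_integral do rewrite EFinM.
rewrite integralZl//.
  rewrite integral_indic ?setIT//; last exact: mX.
  by rewrite [U in (_ * U)%E](qE T k TT) -EFinM mulrC.
by apply: integrable_indic => //; exact: mX.
Qed.

End payoff.

(** * Verification *)

Lemma eq_bounded_measurable (R : realType) (T : R) (h g : R -> R) :
  (forall t, t \in `[0, T] -> h t = g t) ->
  bounded_measurable T h -> bounded_measurable T g.
Proof.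
move=> hg [mh [M hM]]; split.
  by apply: eq_measurable_fun mh => t; rewrite inE => /hg.
by exists M; apply: filterS hM => t H tT; rewrite -hg// H.
Qed.

Lemma dot_vec (R : realType) (N : nat) (V : 'I_N -> {set 'I_N}) i
    (x y : 'I_N -> R) :
  dot (vec V i x) (vec V i y) = \sum_(j in V i) x j * y j.
Proof.
rewrite /dot [RHS]big_enum_val.
by apply: eq_bigr => k _; rewrite !mxE.
Qed.

(** A real [sup] is informative only for a nonempty set bounded above; the maximizer [l] witnesses
    both. *)
Lemma hamiltonian_argmax (R : realType) (n : nat) (L : 'rV[R]_n -> R) p l :
  argmax L p l -> hamiltonian L p = dot l p - L l.
Proof.
move=> [l0 lmax]; apply/eqP; rewrite eq_le; apply/andP; split.
  by apply: ge_sup => [|_ [l' l'0 <-]]; [exists (dot l p - L l); exists l|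
    exact: lmax].
apply: ub_le_sup; last by exists l.
by exists (dot l p - L l) => _ [l' l'0 <-]; exact: lmax.
Qed.

Section verification.
Unset Implicit Arguments.
Context (R : realType) (N : nat) (V : 'I_N -> {set 'I_N}) (T : R)
  (L H : forall i, 'rV[R]_#|V i| -> R) (f g : 'I_N -> 'rV[R]_N -> R)
  (m0 : 'rV[R]_N) (u m : R -> 'rV[R]_N).
Hypothesis V_irrefl : forall i, i \notin V i.
Hypothesis T_gt0 : 0 < T.
Hypothesis L_cont : forall i, {within @orthant R #|V i|, continuous (L i)}.
Hypothesis H_def : forall i p, H i p = hamiltonian (L i) p.
Hypothesis H_C1 : forall i, C1_fun (H i).
Hypothesis H_grad : forall i p, argmax (L i) p = [set grad (H i) p].
Hypothesis m0_simplex : simplex m0.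
Hypothesis u_C1 : forall i, C1_on T (fun t => u t 0 i).
Hypothesis m_C1 : forall i, C1_on T (fun t => m t 0 i).
Hypothesis um_sol : mfg_equations T H f g m0 u m.
Set Implicit Arguments.
Local Notation mu := (@lebesgue_measure R).
Local Notation opt := (fun t i j => partial (H i) j (diffs V i (u t))).

Let T0 : 0 <= T. Proof. exact: ltW. Qed.
Let in0 : 0 \in `[0, T]. Proof. by rewrite in_itv/= lexx. Qed.
Let inT : T \in `[0, T]. Proof. by rewrite in_itv/= lexx andbT. Qed.

Lemma argmax_grad i p : argmax (L i) p (grad (H i) p).
Proof. by rewrite H_grad. Qed.

(** The partial derivatives are the coordinates of the maximizer, which is sought in the orthant. *)
Lemma partial_ge0 i j p : j \in V i -> 0 <= partial (H i) j p.
Proof.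
move=> jV; have [+ _] := argmax_grad p => /(_ (enum_rank_in jV j)).
by rewrite mxE enum_rankK_in.
Qed.

Lemma diffs_cvg i t : t \in `[0, T] ->
  diffs V i (u s) @[s --> within `[0, T] (nbhs t)] --> diffs V i (u t).
Proof.
move=> tT; apply: row_cvg => k; rewrite !mxE; under eq_fun do rewrite mxE.
have cu j : u s 0 j @[s --> within `[0, T] (nbhs t)] --> u t 0 j.
  have [du _] := u_C1 j.
  by have /subspace_continuousP := derivable_on_continuous du; apply.
exact: cvgB.
Qed.

Lemma opt_continuous i j : j \in V i ->
  {within `[0, T], continuous (fun t => opt t i j)}.
Proof.
move=> jV; apply/subspace_continuousP => t tT.
have [_ cH] := H_C1 i.
have := cvg_comp _ _ (@diffs_cvg i _ tT) (cH j jV (diffs V i (u t))).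
exact.
Qed.

Lemma opt_bounded_measurable i j : j \in V i ->
  bounded_measurable T (fun t => opt t i j).
Proof. by move=> jV; apply: bounded_measurable_continuous; exact: opt_continuous. Qed.

Lemma opt_admissible : admissible V T opt.
Proof.
move=> i j jV; have [mo bo] := opt_bounded_measurable jV.
by split => // t _; exact: partial_ge0.
Qed.

Lemma m_simplex t : t \in `[0, T] -> simplex (m t).
Proof.
move=> tT.
have [_ _ mE m0E] := um_sol.
have mE' s i : s \in `[0, T] -> derive_on T (fun s => m s 0 i) s =
    \sum_j m s 0 j * rate_matrix V (opt s) j i.
  by move=> sT; rewrite mE// rate_matrix_forward.
have bQ j i : bounded_measurable T (fun s => rate_matrix V (opt s) j i).
  apply: bounded_measurable_rate_matrix => // k l; exact: opt_bounded_measurable.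
have cm i := derivable_on_continuous (m_C1 i).1.
have sum1 s : s \in `[0, T] -> \sum_i m s 0 i = 1.
  rewrite in_itv/= => /andP[s0 sT].
  have [_ <-] := m0_simplex; rewrite -m0E.
  apply/eqP; rewrite -subr_eq0 -sumrB; apply/eqP.
  under eq_bigr do rewrite -(C1_on_FTC (m_C1 _) (lexx 0) s0 sT).
  rewrite -(@Rintegral_fin_sum _ T)//; last first.
    by move=> i; apply: bounded_measurable_continuous; case: (m_C1 i).
  rewrite (@eq_Rintegral _ _ _ _ _ (fun=> 0)); first by rewrite Rintegral_cst// mul0r.
  move=> r; rewrite inE/= in_itv/= => /andP[r0 rs].
  have rT : r \in `[0, T] by rewrite in_itv/= r0 (le_trans rs).
  under eq_bigr do rewrite mE'//.
  rewrite exchange_big/= big1// => j _.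
  by rewrite -mulr_sumr rate_matrix_row_sum ?mulr0.
(* Pairs that are not edges receive the bound 0; the sum of all [M ij] dominates every rate at once
   and serves as [K] in [forward_equation_ge0]. *)
have /choice[M HM] : forall ij : 'I_N * 'I_N, exists M, 0 <= M /\
    (ij.2 \in V ij.1 -> forall s, s \in `[0, T] -> `|opt s ij.1 ij.2| <= M).
  move=> [i j]; have [jV|jV] := boolP (j \in V i); last by exists 0.
  by have [M M0 HM] := continuous_within_bounded (opt_continuous jV); exists M.
have pos s i : s \in `[0, T] -> 0 <= m s 0 i.
  apply: (@forward_equation_ge0 _ _ _ (\sum_ij M ij)
    (fun s => rate_matrix V (opt s)) (fun s i => m s 0 i)) => //.
  - by apply: sumr_ge0 => ij _; case: (HM ij).
  - by move=> k; case: (m_C1 k).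
  - move=> r k j rT; rewrite mxE; case: ifP => _.
      apply: (@le_trans _ _ 0).
        by rewrite oppr_le0 sumr_ge0// => l lV; exact: partial_ge0.
      by apply: sumr_ge0 => ij _; case: (HM ij).
    case: ifP => kV; last by apply: sumr_ge0 => ij _; case: (HM ij).
    apply: (le_trans (ler_norm _)).
    apply: (le_trans ((HM (j, k)).2 kV r rT)).
    rewrite (bigD1 (j, k))//= lerDl; apply: sumr_ge0 => ij _; by case: (HM ij).
  - move=> r k j rT jk; rewrite rate_matrix_neq//; case: ifP => // kV.
    exact: partial_ge0.
  - by move=> k; rewrite m0E; case: m0_simplex => + _ => /(_ k)/andP[].
split; last exact: sum1.
move=> i; rewrite pos//= -(sum1 t tT) (bigD1 i)//= lerDl.
by apply: sumr_ge0 => j _; exact: pos.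
Qed.

Definition hamiltonian_gap (lam : R -> 'I_N -> 'I_N -> R) s j : R :=
  dot (vec V j (lam s j)) (diffs V j (u s)) - L j (vec V j (lam s j))
  - H j (diffs V j (u s)).

(* [q s j] is the probability of being in [j] at time [s]: sum over [j] the
   product rule for [q s j * u s 0 j] and substitute both evolution equations. *)
Lemma payoff_eq i lam v : admissible V T lam -> J T L f g m 0 i lam v ->
  exists q : R -> 'I_N -> R,
  [/\ forall s j, s \in `[0, T] -> 0 <= q s j,
      bounded_measurable T (fun s => \sum_j q s j * hamiltonian_gap lam s j)
    & v = (u 0 0 i +
        \int[mu]_(s in `[0, T]) (\sum_j q s j * hamiltonian_gap lam s j))%:E].
Proof.
move=> adm [d [Om [P [X [chain ->]]]]].
have [uE uT _ _] := um_sol.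
have [p [tp pE]] := markov_chain_marginal T0 chain.
have [qprob qm qE] := tp 0 in0 i.
pose q s j := p 0 s i j.
have q_ge0 s j : s \in `[0, T] -> 0 <= q s j.
  by move=> sT; have [+ _] := qprob s sT; apply.
have bq j : bounded_measurable T (q ^~ j).
  split; first exact: qm.
  exists 1; apply: aeW => s sT; have [pos sum1] := qprob s sT.
  rewrite ger0_norm ?q_ge0// -sum1 (bigD1 j)//= lerDl.
  by apply: sumr_ge0 => k _; exact: pos.
have blam k j : j \in V k -> bounded_measurable T (fun t => lam t k j).
  by move=> jV; have [] := adm k j jV.
have bL k : bounded_measurable T (fun s => L k (vec V k (lam s k))).
  apply: bounded_measurable_orthant_continuous => //.
    move=> j; under eq_fun do rewrite mxE.
    by apply: blam; exact: enum_valP.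
  by move=> t tT j; rewrite mxE; have [+ _ _] := adm k _ (enum_valP j); apply.
have bH k : bounded_measurable T (fun s => H k (diffs V k (u s))).
  apply: bounded_measurable_continuous; apply/subspace_continuousP => t tT.
  have [dH _] := H_C1 k.
  exact: (cvg_comp _ _ (@diffs_cvg k _ tT) (differentiable_continuous (dH _))).
have bu' k : bounded_measurable T (derive_on T (fun s => u s 0 k)).
  by apply: bounded_measurable_continuous; case: (u_C1 k).
have bu k : bounded_measurable T (fun s => u s 0 k).
  apply: bounded_measurable_continuous; apply: derivable_on_continuous.
  by case: (u_C1 k).
(* The regularity in time of [f] along [m] is read off the backward equation, as that of
   [- (u' + H)]. *)
have bf k : bounded_measurable T (fun s => f k (m s)).
  apply: (@eq_bounded_measurable _ _ (fun s =>
    - (derive_on T (fun s => u s 0 k) s + H k (diffs V k (u s))))).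
    by move=> t tT; have /eqP := uE k t tT; rewrite addr_eq0 => /eqP ->; rewrite opprK.
  by apply: bounded_measurableN; exact: bounded_measurableD.
pose phi k s := - L k (vec V k (lam s k)) + f k (m s).
have bphi k : bounded_measurable T (phi k).
  by apply: bounded_measurableD => //; exact: bounded_measurableN.
pose Q s := rate_matrix V (lam s).
have bQ j k : bounded_measurable T (fun s => Q s j k).
  exact: bounded_measurable_rate_matrix.
pose a k s := \sum_j q s j * Q s j k.
have ba k : bounded_measurable T (a k).
  by apply: bounded_measurable_sum => j _; exact: bounded_measurableM.
have q_forward k r : r \in `[0, T] ->
    q r k = (i == k)%:R + \int[mu]_(v in `[0, r]) a k v.
  move=> rT; rewrite /q qE//; congr (_ + _); apply: eq_Rintegral => s _.
  by rewrite mxE.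
have q0 k : q 0 k = (i == k)%:R.
  by rewrite q_forward// set_itv1 Rintegral_set1 addr0.
have gapE s : s \in `[0, T] -> \sum_j q s j * hamiltonian_gap lam s j =
    \sum_k q s k * phi k s +
    \sum_k (q s k * derive_on T (fun s => u s 0 k) s + a k s * u s 0 k).
  move=> sT; rewrite [X in _ = _ + X]big_split/=.
  (* Duality: exchanging the sums moves the rate matrix from the law [q] to [u], where it acts by
     differences. *)
  have -> : \sum_k a k s * u s 0 k =
      \sum_j q s j * dot (vec V j (lam s j)) (diffs V j (u s)).
    under eq_bigr do rewrite mulr_suml.
    rewrite exchange_big/=; apply: eq_bigr => j _.
    under eq_bigr do rewrite -mulrA.
    by rewrite -mulr_sumr rate_matrix_backward// dot_vec.
  rewrite -!big_split/=; apply: eq_bigr => j _.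
  have /eqP := uE j s sT; rewrite -addrA addr_eq0 => /eqP ->.
  by rewrite /hamiltonian_gap /phi; ring.
exists q; split => //.
  apply: bounded_measurable_sum => j _; apply: bounded_measurableM => //.
  apply: bounded_measurableD; last exact: bounded_measurableN.
  apply: bounded_measurableD; last exact: bounded_measurableN.
  under eq_fun do rewrite dot_vec.
  apply: bounded_measurable_sum => k kV; apply: bounded_measurableM.
    exact: blam.
  by apply: bounded_measurableD => //; exact: bounded_measurableN.
rewrite /expected_payoff.
rewrite (expectation_running_terminal T0 chain
  (phi := phi) (fun k => g k (m T)) (q := q))//.
congr EFin.
(* The terminal condition turns the terminal payoff into the sum of the [q T k * u T 0 k], to which
   the product rule applies for each [k]. Since [q 0] is the point mass at [i], the boundary terms
   at time 0 reduce to [u 0 0 i]. *)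
have -> : \sum_k q T k * g k (m T) = u 0 0 i +
    \int[mu]_(s in `[0, T])
      (\sum_k (q s k * derive_on T (fun s => u s 0 k) s + a k s * u s 0 k)).
  rewrite (@Rintegral_fin_sum _ T)//; last first.
    by move=> k; apply: bounded_measurableD; exact: bounded_measurableM.
  under [X in _ = _ + X]eq_bigr => k _ do
    rewrite -(integral_product_rule T0 (bq k) (ba k) (q_forward k) (u_C1 k)).
  rewrite sumrB addrCA -[LHS]addr0; congr (_ + _).
    by apply: eq_bigr => k _; rewrite uT.
  rewrite (bigD1 i)//= big1 ?addr0.
    by rewrite q0 eqxx mul1r subrr.
  by move=> k ki; rewrite q0 eq_sym (negbTE ki) mul0r.
rewrite addrCA; congr (_ + _).
rewrite -RintegralD//.
- by apply: eq_Rintegral => s; rewrite inE/= => sT; rewrite gapE.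
- apply: (bounded_measurable_integrable _ (lexx 0) (lexx T)).
  by apply: bounded_measurable_sum => k _; exact: bounded_measurableM.
- apply: (bounded_measurable_integrable _ (lexx 0) (lexx T)).
  apply: bounded_measurable_sum => k _.
  by apply: bounded_measurableD; exact: bounded_measurableM.
Qed.

Lemma hamiltonian_gap_le0 lam s j : admissible V T lam -> s \in `[0, T] ->
  hamiltonian_gap lam s j <= 0.
Proof.
move=> adm sT; rewrite /hamiltonian_gap subr_le0 H_def.
rewrite (hamiltonian_argmax (argmax_grad _)).
have [_] := argmax_grad (diffs V j (u s)); apply => k.
by rewrite mxE; have [+ _ _] := adm j _ (enum_valP k); apply.
Qed.

Lemma hamiltonian_gap_opt s j : hamiltonian_gap opt s j = 0.
Proof.
by rewrite /hamiltonian_gap H_def (hamiltonian_argmax (argmax_grad _)) subrr.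
Qed.

(** The two payoffs may live on different probability spaces with different laws; zero separates
    their gap integrals. *)
Lemma opt_optimal : optimal_control T L f g m opt.
Proof.
have [_ _ mE _] := um_sol.
split; [exact: opt_admissible| |by move=> i t tT; rewrite mE].
move=> lam adm i v v' /(payoff_eq opt_admissible)[q [_ _ ->]].
move=> /(payoff_eq adm)[q' [q'0 bgap ->]].
rewrite lee_fin lerD2l.
apply: (@le_trans _ _ 0).
  have int0 : \int[mu]_(s in `[0, T]) (0 : R) = 0 by rewrite Rintegral_cst// mul0r.
  rewrite -[leRHS]int0; apply: le_Rintegral => //.
  - exact: (bounded_measurable_integrable bgap (lexx 0) (lexx T)).
  - exact: (bounded_measurable_integrable (bounded_measurable_cst T 0) (lexx 0) (lexx T)).
  - move=> s sT; apply: sumr_le0 => j _; apply: mulr_ge0_le0; first exact: q'0.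
    exact: hamiltonian_gap_le0.
apply: Rintegral_ge0 => s _.
by rewrite big1// => j _; rewrite hamiltonian_gap_opt mulr0.
Qed.

End verification.

Unset Implicit Arguments.
Set Strict Implicit.
Set Printing Implicit Defensive.

Theorem proposition1 (R : realType) (N : nat) (V : 'I_N -> {set 'I_N})
    (V_irrefl : forall i, i \notin V i)
    (T : R) (T_gt0 : 0 < T)
    (L : forall i, 'rV[R]_#|V i| -> R)
    (L_cont : forall i, {within @orthant R #|V i|, continuous (L i)})
    (L_superlinear : forall i, superlinear (L i))
    (H : forall i, 'rV[R]_#|V i| -> R)
    (H_def : forall i p, H i p = hamiltonian (L i) p)
    (H_C1 : forall i, C1_fun (H i))
    (H_grad : forall i p, argmax (L i) p = [set grad (H i) p])
    (Omega : set 'rV[R]_N)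
    (Omega_open : open Omega) (Omega_connected : connected Omega)
    (simplex_Omega : @simplex R N `<=` Omega)
    (f g : 'I_N -> 'rV[R]_N -> R)
    (f_cont : forall i, {within Omega, continuous (f i)})
    (g_cont : forall i, {within Omega, continuous (g i)})
    (m0 : 'rV[R]_N) (m0_simplex : simplex m0)
    (u m : R -> 'rV[R]_N)
    (m_Omega : forall t, t \in `[0, T] -> Omega (m t))
    (u_C1 : forall i, C1_on T (fun t => u t 0 i))
    (m_C1 : forall i, C1_on T (fun t => m t 0 i))
    (um_sol : mfg_equations T H f g m0 u m) :
  nash_mfg_equilibrium T L f g m /\
  optimal_control T L f g m
    (fun t i j => partial (H i) j (diffs V i (u t))).
Proof.
have opt_ok := opt_optimal V_irrefl T_gt0 L_cont H_def H_C1 H_grad u_C1 um_sol.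
split => //; split.
- move=> t tT.
  exact: (m_simplex V_irrefl H_C1 H_grad m0_simplex u_C1 m_C1 um_sol tT).
- by move=> i; case: (m_C1 i).
- by exists (fun t i j => partial (H i) j (diffs V i (u t))).
Qed.
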